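(* Let $G$ be an amenable group generated by a finite symmetric set $S$, let $\mathcal A$ be a finite set and $\mathcal C:G\to\mathcal A$ a colouring. Let $(Q_n)_{n\in\mathbb N}$ be a Følner sequence in $G$ such that each $Q_n$ symmetrically tiles $G$, and let $(U_j)_{j\in\mathbb N}$ be a Følner sequence along which the frequencies $\nu_P=\lim_{j\to\infty}|U_j|^{-1}\sharp_P(\mathcal C|_{U_j})$ exist for all patterns $P\in\bigcup_{n\in\mathbb N}\mathcal P(Q_n)$. Let $(X,\|\cdot\|)$ be a Banach space and let $F:\mathcal F(G)\to X$ be $\mathcal C$-invariant and almost additive with boundary term $b$. Let $C>0$ be a constant with $\|F(Q)\|\le C|Q|$ for all $Q\in\mathcal F(G)$ (such a constant exists) and $D>0$ a constant with $b(Q)\le D|Q|$ for all $Q\in\mathcal F(G)$. Let $\overline F:=\lim_{j\to\infty}F(U_j)/|U_j|\in X$ (this limit exists). Then for all $j,n\in\mathbb N$ $$\Big\|\overline F-\frac{F(U_j)}{|U_j|}\Big\|\le2\frac{b(Q_n)}{|Q_n|}+(C+D)\frac{|\partial^{\operatorname{diam}(Q_n)}U_j|}{|U_j|}+C\sum_{P\in\mathcal P(Q_n)}\Big|\frac{\sharp_P(\mathcal C|_{U_j})}{|U_j|}-\nu_P\Big|$$ and $$\Big\|\overline F-\sum_{P\in\mathcal P(Q_n)}\nu_P\frac{\tilde F(P)}{|Q_n|}\Big\|\le\frac{b(Q_n)}{|Q_n|}.$$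
   Context: Symmetric means $S=S^{-1}$. Word metric: $d_S(g,h)$ is the minimal $L\in\mathbb N_0$ such that $g^{-1}h$ is a product of $L$ elements of $S$. $\mathcal F(G)$ is the set of finite subsets of $G$, $|Q|$ is cardinality, $\operatorname{diam}(Q)=\max\{d_S(g,h): g,h\in Q\}$. For $Q\in\mathcal F(G)$ and $R\ge 0$: $\partial_{int}^R(Q)=\{x\in Q: d_S(x,G\setminus Q)\le R\}$, $\partial_{ext}^R(Q)=\{x\in G\setminus Q: d_S(x,Q)\le R\}$, $\partial^R(Q)=\partial^R_{int}(Q)\cup\partial^R_{ext}(Q)$. A Følner sequence is a sequence $(Q_n)$ of finite (nonempty) subsets of $G$ with $\lim_{n\to\infty} |Q_nS\setminus Q_n|/|Q_n|=0$. A set $Q\subseteq G$ symmetrically tiles $G$ if there is $K\subseteq G$ with $K=K^{-1}$ such that the sets $Qg$, $g\in K$, are pairwise disjoint and have union $G$. A colouring is a map $\mathcal C:G\to\mathcal A$; a pattern is a map $P:D(P)\to\mathcal A$ with $D(P)\in\mathcal F(G)$; $\mathcal P$ is the set of all patterns, $\mathcal P(Q)$ the set of patterns with domain $Q$. The translate $Px$ ($x\in G$) is the pattern $D(P)x\to\mathcal A$, $yx\mapsto P(y)$. Two patterns are equivalent if one is a translate of the other. $\sharp_P(P')=|\{x\in G: D(P)x\subseteq D(P'),\ P'|_{D(P)x}=Px\}|$. The limit $\nu_P=\lim_j\sharp_P(\mathcal C|_{U_j})/|U_j|$, if it exists, is called the frequency of $P$ in $\mathcal C$ along $(U_j)$.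 A boundary term is a function $b:\mathcal F(G)\to[0,\infty)$ such that (a) $b(Qx)=b(Q)$ for all $x\in G$, $Q\in\mathcal F(G)$; (b) $b(V_j)/|V_j|\to0$ for every Følner sequence $(V_j)$; (c) there is $D>0$ with $b(Q)\le D|Q|$ for all $Q\in\mathcal F(G)$. $F:\mathcal F(G)\to X$ is $\mathcal C$-invariant if $F(Q)=F(Qx)$ whenever $\mathcal C|_Q$ and $\mathcal C|_{Qx}$ are equivalent patterns, and almost additive with boundary term $b$ if $\|F(\bigcup_{k=1}^mQ_k)-\sum_{k=1}^mF(Q_k)\|\le\sum_{k=1}^mb(Q_k)$ for all pairwise disjoint $Q_1,\dots,Q_m\in\mathcal F(G)$. For a pattern $P$, $\tilde F(P):=F(Q)$ if there is $Q\in\mathcal F(G)$ such that $\mathcal C|_Q$ is equivalent to $P$ (well defined by $\mathcal C$-invariance), and $\tilde F(P):=0$ otherwise.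
   Formalization: The word metric is taken as the length of gh⁻¹ (not g⁻¹h) and Følner means |SQ_n∖Q_n|/|Q_n|→0 (not Q_nS), to match right translates Qx; with the sides as written the claim fails in the infinite dihedral group. Abelian groups are unaffected. *)

(* Defs.v *)
From HB Require Import structures.
From mathcomp Require Import all_boot all_order all_algebra.
From mathcomp Require Import finmap.
From mathcomp Require Import all_classical all_reals all_analysis.
Set Implicit Arguments.
Unset Strict Implicit.
Unset Printing Implicit Defensive.
Import Order.TTheory GRing.Theory Num.Theory.
Import numFieldNormedType.Exports.
Local Open Scope classical_set_scope.
Local Open Scope ring_scope.

(* Side convention: sets are translated, tiled and compared on the right (Q x,
   P x), so the metric is the right-invariant word metric (word length of
   g h^-1) and Foelner sets are almost invariant under left multiplication by S.
   With the opposite choice (word length of g^-1 h and Q_n S \ Q_n) the theorem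
   fails.  In the infinite dihedral group with S = {t, t^-1, s}, take
   Q_n = {t^i, t^i s : |i| <= n} (tiled by the powers of t^(2n+1)),
   U_j = t^(j+1) Q_j, F(Q) = |Q| and b = 0.  No Q_n x is contained in any U_j,
   because Q_n t^a and Q_n t^a s contain t^a and t^-a up to a factor s, while
   U_j = {t^i, t^i s : 1 <= i <= 2j+1}; so all frequencies vanish although the
   mean of F is 1. *)

Section Group.
Variable G : groupType.
Implicit Types (S Q : {fset G}) (g h x : G) (R : realType).

Definition is_word S (g : G) (L : nat) : Prop :=
  exists w : L.-tuple G,
    all [in S] w /\ g = (\prod_(s <- w) s)%g.

Definition symmetric_fset S : Prop := S = [fset (s^-1)%g | s in S]%fset.

(* for symmetric S, the subgroup generated by S consists of the words in S *)
Definition generates S : Prop := forall g, exists L, is_word S g L.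

(* default value 0, used only when g h^-1 is not a product of elements of S *)
Definition word_dist S g h : nat :=
  if pselect (exists L, `[< is_word S (g * h^-1)%g L >]) is left ex
  then ex_minn ex else 0%N.

Definition diam S Q : nat :=
  \max_(g <- Q) \max_(h <- Q) word_dist S g h.

(* +oo when A is empty *)
Definition dist_set R S x (A : set G) : \bar R :=
  ereal_inf [set ((word_dist S x y)%:R)%:E | y in A].

Definition boundary_int R S (r : R) Q : set G :=
  [set x | x \in Q /\ (dist_set R S x (~` [set` Q]) <= r%:E)%E].

Definition boundary_ext R S (r : R) Q : set G :=
  [set x | x \notin Q /\ (dist_set R S x [set` Q] <= r%:E)%E].

Definition boundary R S (r : R) Q : set G :=
  boundary_int S r Q `|` boundary_ext S r Q.

(* cardinality of a finite subset of G (0 on infinite sets) *)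
Definition card_set (A : set G) : nat := #|` fset_set A|.

Definition rtranslate Q x : {fset G} := [fset (y * x)%g | y in Q]%fset.

Definition lmul S Q : {fset G} := [fset (s * q)%g | s in S, q in Q]%fset.

Definition folner R S (Q : nat -> {fset G}) : Prop :=
  (forall n, Q n != fset0) /\
  (fun n => (#|` (lmul S (Q n) `\` Q n)%fset|)%:R / (#|` Q n|)%:R : R)
    @ \oo --> (0 : R).

Definition amenable R S : Prop := exists V : nat -> {fset G}, folner R S V.

Definition symmetrically_tiles Q : Prop :=
  exists K : set G,
    [/\ K = [set (g^-1)%g | g in K],
        trivIset K (fun g => [set` rtranslate Q g]) &
        \bigcup_(g in K) [set` rtranslate Q g] = setT].

Definition boundary_term R S (b : {fset G} -> R) : Prop :=
  [/\ forall Q, 0 <= b Q,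
      forall Q x, b (rtranslate Q x) = b Q,
      forall V : nat -> {fset G}, folner R S V ->
        (fun j => b (V j) / (#|` V j|)%:R) @ \oo --> (0 : R) &
      exists2 D : R, 0 < D & forall Q, b Q <= D * (#|` Q|)%:R].

Section Patterns.
Variable A : finType.

Definition pattern := {fmap G -> A}.

Definition pattern_of Q (f : {ffun Q -> A}) : pattern := FinMap f.

Lemma rtranslate_inv Q x (z : rtranslate Q x) : (val z * x^-1)%g \in Q.
Proof. by have /imfsetP[y /= yQ ->] := valP z; rewrite mulgK. Qed.

Definition ptranslate (P : pattern) x : pattern :=
  [fmap z : rtranslate (domf P) x => P [` rtranslate_inv z]%fset].

Definition pequiv (P P' : pattern) : Prop := exists x, P' = ptranslate P x.

Definition crestrict (col : G -> A) Q : pattern := [fmap x : Q => col (val x)].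

(* number of occurrences of P in P' *)
Definition occ (P P' : pattern) : nat :=
  card_set [set x | (rtranslate (domf P) x `<=` domf P')%fset /\
                    P'.[& rtranslate (domf P) x]%fmap = ptranslate P x].

Definition rel_occ R (col : G -> A) (U : nat -> {fset G}) (P : pattern)
  (j : nat) : R := (occ P (crestrict col (U j)))%:R / (#|` U j|)%:R.

Definition frequency R (col : G -> A) (U : nat -> {fset G}) (P : pattern) : R :=
  limn (rel_occ R col U P).

Definition col_invariant (X : Type) (col : G -> A) (F : {fset G} -> X) : Prop :=
  forall Q x, pequiv (crestrict col Q) (crestrict col (rtranslate Q x)) ->
    F Q = F (rtranslate Q x).

Definition pattern_fun (X : zmodType) (col : G -> A) (F : {fset G} -> X)
  (P : pattern) : X :=
  if pselect (exists Q, pequiv (crestrict col Q) P) is left ex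
  then F (projT1 (cid ex)) else 0.

End Patterns.

Definition almost_additive R (X : normedModType R) (F : {fset G} -> X)
  (b : {fset G} -> R) : Prop :=
  forall (m : nat) (Q : 'I_m -> {fset G}), (0 < m)%N ->
    (forall k l, k != l -> [disjoint Q k & Q l]%fset) ->
    `| F (\bigcup_(k <- enum 'I_m) Q k)%fset - \sum_(k < m) F (Q k) |
      <= \sum_(k < m) b (Q k).

Definition mean R (X : normedModType R) (F : {fset G} -> X)
  (U : nat -> {fset G}) (j : nat) : X := (#|` U j|)%:R^-1 *: F (U j).

End Group.

(* Main.v *)
Require Import Defs.
From mathcomp Require Import all_boot all_order all_algebra.
From mathcomp Require Import finmap.
From mathcomp Require Import all_classical all_reals all_analysis.
From mathcomp Require Import ring lra.
Import Order.TTheory GRing.Theory Num.Theory.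
Import numFieldNormedType.Exports.
Local Open Scope classical_set_scope.
Local Open Scope ring_scope.

(** Let [Q] tile [G] by the translates [Q k] with [k] in [K = K^-1].  For every
    [q] in [Q] the sets [Q k q^-1] form a tiling too, and since [K] is symmetric
    every [g] in [G] is [k q^-1] for exactly one pair [(k, q)].  Inside a finite
    set [U], the tiles of the [q]-th tiling contained in [U] miss only points of
    [U] at distance at most [diam Q] from the complement, so almost additivity
    compares [F U] with the sum of [F] over these tiles.  Averaging over [q]
    counts each translate of [Q] contained in [U] once, and sorting the
    translates by the pattern they carry yields the occurrence numbers:
      |F U/|U| - sum_P occ_P/|U| F(P)/|Q|| <= b Q/|Q| + (C + D) |boundary U|/|U|.
    Letting [U] run through the Foelner sequence makes the boundary term vanish,
    so for every [n] the means are asymptotically within [b Q_n/|Q_n|] of the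
    point [sum_P nu_P F(P)/|Q_n|]: they are Cauchy and both bounds follow. *)

Set Implicit Arguments.
Unset Strict Implicit.
Unset Printing Implicit Defensive.

(** * Word metric and boundaries *)

Section WordMetric.
Variables (G : groupType) (S : {fset G}).
Implicit Types (U V W : {fset G}) (g h w x y z : G) (r : nat).

Definition ltranslate w U : {fset G} := [fset (w * u)%g | u in U]%fset.

(** Adjoining [1] to [S] makes the [r]-fold product contain the words of every length up to [r],
    since shorter words can be padded. *)
Definition word_ball r : {fset G} := iter r (lmul (1%g |` S)%fset) [fset 1%g]%fset.

Lemma mem_ltranslate w U x : (x \in ltranslate w U) = ((w^-1 * x)%g \in U).
Proof.
apply/imfsetP/idP => [[u /= uU ->]|xU]; first by rewrite mulKg.
by exists (w^-1 * x)%g; rewrite //= mulVKg.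
Qed.

Lemma mem_rtranslate U g x : (x \in rtranslate U g) = ((x * g^-1)%g \in U).
Proof.
apply/imfsetP/idP => [[u /= uU ->]|xU]; first by rewrite mulgK.
by exists (x * g^-1)%g; rewrite //= mulgVK.
Qed.

Lemma rtranslateM U g h :
  rtranslate (rtranslate U g) h = rtranslate U (g * h)%g.
Proof. by apply/fsetP => x; rewrite !mem_rtranslate invgM mulgA. Qed.

Lemma card_ltranslate w U : #|` ltranslate w U| = #|` U|.
Proof. by rewrite card_imfset //; exact: mulgI. Qed.

Lemma card_rtranslate U g : #|` rtranslate U g| = #|` U|.
Proof. by rewrite card_imfset //; exact: mulIg. Qed.

Lemma card_fsetDC U V : #|` U| = #|` V| ->
  #|` (U `\` V)%fset| = #|` (V `\` U)%fset|.
Proof. by move=> UV; rewrite !cardfsD UV fsetIC. Qed.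

Lemma leq_card_fsetU U V : (#|` (U `|` V)%fset| <= #|` U| + #|` V|)%N.
Proof. by rewrite cardfsU leq_subr. Qed.

Lemma lmulS1_sub s U : s \in (1%g |` S)%fset ->
  (ltranslate s U `\` U `<=` lmul S U `\` U)%fset.
Proof.
move=> sS; apply/fsubsetP => x; rewrite !inE mem_ltranslate => /andP[xU sxU].
rewrite xU /=; apply/imfset2P; exists s; last by exists (s^-1 * x)%g; rewrite ?mulVKg.
by move: sS xU; rewrite !inE => /orP[/eqP s1|//]; rewrite s1 invg1 mul1g in sxU *; rewrite sxU.
Qed.

(** Peel off the first letter: a point of [s v U] outside [U] lies in [s (v U \ U)] or in [s U \ U].
    Left translation preserves cardinality, so each letter costs at most one copy of [S U \ U]. *)
Lemma card_ltranslateD r w U : w \in word_ball r ->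
  (#|` (ltranslate w U `\` U)%fset| <= r * #|` (lmul S U `\` U)%fset|)%N.
Proof.
elim: r w => [|r IH] w.
  rewrite /word_ball /= inE => /eqP ->; rewrite mul0n leqn0 cardfs_eq0.
  apply/eqP/fsetP => x; rewrite !inE mem_ltranslate invg1 mul1g.
  by case: (x \in U).
rewrite /word_ball iterS => /imfset2P[s /= sS [v vr ->]].
have step : (ltranslate (s * v)%g U `\` U `<=`
    ltranslate s (ltranslate v U `\` U) `|` (ltranslate s U `\` U))%fset.
  apply/fsubsetP => x; rewrite !inE !mem_ltranslate !inE !mem_ltranslate invgM !mulgA.
  by move=> /andP[-> ->]; rewrite andbT orNb.
apply: leq_trans (fsubset_leq_card step) _.
apply: leq_trans (leq_card_fsetU _ _) _.
by rewrite card_ltranslate mulSn addnC leq_add ?IH ?fsubset_leq_card ?lmulS1_sub.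
Qed.

Lemma is_word_ball r g L : (L <= r)%N -> is_word S g L -> g \in word_ball r.
Proof.
move=> Lr [w [wS ->]]; have := size_tuple w.
move: (tval w) wS => {g}w wS wL; rewrite -wL in Lr => {L wL}.
elim: r w wS Lr => [|r IH] [|s w] //= wS Lr.
- by rewrite big_nil /word_ball /= inE.
- have := IH [::] isT isT; rewrite big_nil => one_r; apply/imfset2P.
  by exists 1%g; [rewrite /= !inE eqxx|exists 1%g; rewrite ?mulg1].
- case/andP: wS => sS wS; rewrite big_cons; apply/imfset2P; exists s.
    by rewrite /= !inE sS orbT.
  by exists (\prod_(j <- w) j)%g => //; exact: IH.
Qed.

Lemma word_dist_ball r g h : generates S ->
  (word_dist S g h <= r)%N -> (g * h^-1)%g \in word_ball r.
Proof.
move=> gen; rewrite /word_dist; case: pselect => [ex|[]]; last first.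
  by have [L gL] := gen (g * h^-1)%g; exists L; apply/asboolP.
by case: ex_minnP => L /asboolP gL _ Lr; exact: is_word_ball gL.
Qed.

Lemma word_dist_rtranslate g h x :
  word_dist S (g * x)%g (h * x)%g = word_dist S g h.
Proof. by rewrite /word_dist invgM mulgA mulgK. Qed.

Lemma word_dist_diam U g h : g \in U -> h \in U ->
  (word_dist S g h <= diam S U)%N.
Proof.
move=> gU hU; rewrite /diam.
apply: leq_trans (leq_bigmax_seq g gU isT).
exact: (leq_bigmax_seq h hU isT).
Qed.

Lemma dist_set_le (R : realType) r x (B : set G) :
  (dist_set R S x B <= r%:R%:E)%E <->
  exists2 y, B y & (word_dist S x y <= r)%N.
Proof.
split=> [le_r|[y By yr]]; last first.
  by apply: ge_ereal_inf; exists (word_dist S x y)%:R%:E; [exists y|rewrite lee_fin ler_nat].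
apply: contrapT => noy; move: le_r; apply/negP; rewrite -ltNge.
(* Distances are integers: if none is at most [r], all are at least [r + 1], and so is their
   infimum. This also covers an empty [B], where it is infinite. *)
apply: (@lt_le_trans _ _ (r.+1)%:R%:E); first by rewrite lte_fin ltr_nat.
apply: le_ereal_inf_tmp => _ [y By <-]; rewrite lee_fin ler_nat ltnNge.
by apply/negP => yr; apply: noy; exists y.
Qed.

(* [w U] and [U] have the same cardinality, so both differences are controlled by
   [card_ltranslateD]. *)
Definition shift_boundary r U : {fset G} :=
  (\bigcup_(w <- word_ball r) ((ltranslate w U `\` U) `|` (U `\` ltranslate w U)))%fset.

Lemma boundary_sub (R : realType) r U : generates S ->
  boundary S (r%:R : R) U `<=` [set` shift_boundary r U].
Proof.
(* With [w = x y^-1] one has [w^-1 x = y], so [x] lies in [w U] iff [y] lies in [U]; as [x] and [y]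
   are on opposite sides of [U], [x] is in one of the two differences. *)
move=> gen x [[xU /dist_set_le[y yU xy]]|[xU /dist_set_le[y yU xy]]] /=;
  apply/bigfcupP; exists (x * y^-1)%g; rewrite ?word_dist_ball //;
  rewrite !inE mem_ltranslate invgM invgK mulgVK.
- by move/negP: yU => /negbTE ->; rewrite xU orbT.
- by rewrite xU; move: yU => /= ->.
Qed.

Lemma finite_boundary (R : realType) r U : generates S ->
  finite_set (boundary S (r%:R : R) U).
Proof. by move=> gen; apply: sub_finite_set (boundary_sub gen) _; exact: finite_fset. Qed.

Lemma card_fset_bigcup (I : Type) (s : seq I) (E : I -> {fset G}) :
  (#|` (\bigcup_(i <- s) E i)%fset| <= \sum_(i <- s) #|` E i|)%N.
Proof.
elim/big_rec2: _ => [|i y1 y2 _ le]; first by rewrite cardfs0.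
by rewrite (leq_trans (leq_card_fsetU _ _)) // leq_add2l.
Qed.

Lemma card_boundary (R : realType) r U : generates S ->
  (card_set (boundary S (r%:R : R) U) <=
    #|` word_ball r| * (r * #|` (lmul S U `\` U)%fset|).*2)%N.
Proof.
move=> gen; apply: (@leq_trans #|` shift_boundary r U|).
  apply/fsubset_leq_card/fsubsetP => x.
  rewrite in_fset_set ?inE; last exact: finite_boundary.
  exact: boundary_sub.
apply: leq_trans (card_fset_bigcup _ _) _.
rewrite card_fset_sum1 big_distrl /= !big_seq.
apply: leq_sum => w wr; rewrite mul1n -addnn.
apply: leq_trans (leq_card_fsetU _ _) _.
by rewrite (@card_fsetDC U) ?card_ltranslate // leq_add ?card_ltranslateD.
Qed.
End WordMetric.

(** * Pattern counting *)

Section PatternCount.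
Variables (G : groupType) (A : finType) (col : G -> A).
Implicit Types (Q U V : {fset G}) (P : pattern G A) (g k x : G).

Lemma fnd_crestrict Q k :
  (crestrict col Q).[? k]%fmap = if k \in Q then Some (col k) else None.
Proof.
by case: fndP => // kQ; rewrite /crestrict ffunE.
Qed.

Lemma fnd_ptranslate P x k :
  (ptranslate P x).[? k]%fmap = P.[? (k * x^-1)%g]%fmap.
Proof.
case: fndP => [kP|]; first by rewrite ffunE Some_fnd.
by rewrite /= mem_rtranslate => kP; rewrite not_fnd.
Qed.

(** The colouring of [Q x] pulled back to [Q]: an element of a finite type, by which translates can
    be sorted. *)
Definition trace_pattern Q x : {ffun Q -> A} :=
  [ffun y => col (val y * x)%g].

Lemma fnd_trace_pattern Q x k :
  (pattern_of (trace_pattern Q x)).[? k]%fmap =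
    if k \in Q then Some (col (k * x)%g) else None.
Proof.
by case: fndP => // kQ; rewrite /pattern_of ffunE.
Qed.

Lemma ptranslate_trace_pattern Q x :
  ptranslate (pattern_of (trace_pattern Q x)) x =
    crestrict col (rtranslate Q x).
Proof.
apply/fmapP => k; rewrite fnd_ptranslate fnd_trace_pattern fnd_crestrict.
by rewrite mem_rtranslate mulgVK.
Qed.

Lemma ptranslate_inj x : injective (fun P => ptranslate P x).
Proof.
move=> P P' /fmapP PP'; apply/fmapP => k.
by have := PP' (k * x)%g; rewrite !fnd_ptranslate mulgK.
Qed.

Lemma pattern_of_inj Q : injective (@pattern_of G A Q).
Proof.
move=> f f' /fmapP ff'; apply/ffunP => y; apply: Some_inj.
rewrite -[f]/(ffun_of_fmap (pattern_of f)) -[f']/(ffun_of_fmap (pattern_of f')).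
by rewrite !Some_fnd ff'.
Qed.

Lemma restrict_crestrict U V : (V `<=` U)%fset ->
  (crestrict col U).[& V]%fmap = crestrict col V.
Proof.
move=> /fsubsetP VU; apply/fmapP => k; rewrite fnd_restrict !fnd_crestrict.
by case: ifP => // /VU ->.
Qed.

(** The candidates [q^-1 u] make this a finite set by construction. For nonempty [Q] they include
    every [g] with [Q g] inside [U]. *)
Definition translates_in Q U : {fset G} :=
  [fset g in [fset (q^-1 * u)%g | q in Q, u in U] | (rtranslate Q g `<=` U)%fset]%fset.

Lemma mem_translates_in Q U g : Q != fset0 ->
  (g \in translates_in Q U) = (rtranslate Q g `<=` U)%fset.
Proof.
case/fset0Pn => q qQ; rewrite !inE andb_idl // => /fsubsetP QU.
apply/imfset2P; exists q => //; exists (q * g)%g; rewrite ?mulKg //=.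
by apply: QU; rewrite mem_rtranslate mulgK.
Qed.

(** For a fixed [q] in [Q], the injection sending [g] to [q g] maps these translates into [U]. *)
Lemma leq_card_translates_in Q U : Q != fset0 ->
  (#|` translates_in Q U| <= #|` U|)%N.
Proof.
move=> Q0; have /fset0Pn[q qQ] := Q0.
rewrite -(card_ltranslate q); apply: fsubset_leq_card; apply/fsubsetP => x.
case/imfsetP => g /=; rewrite mem_translates_in // => /fsubsetP QU ->.
by apply: QU; rewrite mem_rtranslate mulgK.
Qed.

Lemma occE Q U (f : {ffun Q -> A}) : Q != fset0 ->
  occ (pattern_of f) (crestrict col U) =
    #|` [fset g in translates_in Q U | trace_pattern Q g == f]%fset|.
Proof.
move=> Q0; rewrite /occ /card_set; congr #|` _|.
rewrite -[RHS]set_fsetK; congr fset_set; apply/seteqP; split=> g /=.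
  move=> [QU]; rewrite restrict_crestrict // -ptranslate_trace_pattern.
  move=> tf; have {}tf := pattern_of_inj (ptranslate_inj tf).
  by rewrite !(mem_translates_in _ _ Q0, inE) /= QU tf /=.
rewrite !(mem_translates_in _ _ Q0, inE) /= => /andP[QU /eqP <-]; split => //.
by rewrite restrict_crestrict // -ptranslate_trace_pattern.
Qed.

(** * The function induced on patterns *)

Section PatternFun.
Variables (R : realType) (X : normedModType R) (F : {fset G} -> X).

(** This is the well-definedness of the function on patterns: whichever [V] was chosen, [Q g] is a
    translate of [V] carrying an equivalent pattern, and [F] is invariant. *)
Lemma pattern_fun_trace Q g : col_invariant col F ->
  pattern_fun col F (pattern_of (trace_pattern Q g)) = F (rtranslate Q g).
Proof.
move=> F_inv; rewrite /pattern_fun; case: pselect => [ex|[]]; last first.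
  exists (rtranslate Q g), g^-1%g; apply/fmapP => k.
  rewrite fnd_ptranslate fnd_trace_pattern fnd_crestrict mem_rtranslate.
  by rewrite invgK mulgK.
case: (cid ex) => V /= [x /fmapP VP].
suff -> : rtranslate Q g = rtranslate V (x * g)%g.
  apply: F_inv; exists (x * g)%g; apply/fmapP => k.
  rewrite fnd_ptranslate !fnd_crestrict mem_rtranslate; rewrite invgM mulgA.
  case: ifP => // kV; have := VP (k * g^-1)%g.
  by rewrite fnd_ptranslate fnd_trace_pattern fnd_crestrict kV mulgVK; case: ifP.
(* Equal patterns have equal domains. *)
have QE : Q = rtranslate V x by apply/fsetP => k; have := VP k;
  rewrite fnd_ptranslate fnd_trace_pattern fnd_crestrict mem_rtranslate; do 2 case: ifP.
by rewrite QE rtranslateM.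
Qed.

Lemma sum_occ Q U : Q != fset0 -> col_invariant col F ->
  \sum_(f : {ffun Q -> A}) (occ (pattern_of f) (crestrict col U))%:R *:
     pattern_fun col F (pattern_of f) =
  \sum_(g <- translates_in Q U) F (rtranslate Q g).
Proof.
move=> Q0 F_inv.
rewrite (partition_big (fun g => trace_pattern Q g) predT) //=.
apply: eq_bigr => f _.
rewrite occE // (eq_bigr (fun=> pattern_fun col F (pattern_of f))); last first.
  by move=> g /eqP <-; rewrite pattern_fun_trace.
rewrite big_fset_condE /= big_const_seq count_predT iter_addr_0.
by rewrite scaler_nat.
Qed.

Lemma norm_pattern_fun (C : R) P :
  (forall V, `|F V| <= C * #|` V|%:R) -> `|pattern_fun col F P| <= C * #|` domf P|%:R.
Proof.
move=> FC; rewrite /pattern_fun; case: pselect => [ex|_]; last first.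
  (* For a pattern that does not occur the value is 0, and the bound is nonnegative because it
     dominates the norm of [F (domf P)]. *)
  by rewrite normr0 (le_trans _ (FC (domf P))).
case: (cid ex) => V /= [x ->] /=; by rewrite card_rtranslate.
Qed.

End PatternFun.
End PatternCount.

(** * Almost additive functions and tilings *)

Lemma rtranslate_fset1 (G : groupType) (x g : G) :
  rtranslate [fset x]%fset g = [fset (x * g)%g]%fset.
Proof.
by apply/fsetP => y; rewrite mem_rtranslate !inE -(inj_eq (mulIg g)) mulgVK.
Qed.

Lemma bigfcup_fset1 (T : choiceType) (V : {fset T}) :
  (\bigcup_(x <- V) [fset x])%fset = V.
Proof. by rewrite bigfcup_imfset1; apply/fsetP => x; rewrite imfset_id. Qed.

Section AlmostAdditive.
Variables (R : realType) (G : groupType) (S : {fset G}) (X : normedModType R).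
Variables (F : {fset G} -> X) (b : {fset G} -> R).
Hypotheses (b_bd : boundary_term S b) (F_aadd : almost_additive F b).
Implicit Types (Q U V : {fset G}) (g x : G).

Lemma almost_additive_seq (s : seq {fset G}) : s != [::] ->
  pairwise (fun V W => [disjoint V & W]%fset) s ->
  `|F (\bigcup_(V <- s) V)%fset - \sum_(V <- s) F V| <= \sum_(V <- s) b V.
Proof.
move=> s0 /(pairwiseP fset0) s_dis.
have := F_aadd (m := size s) (Q := fun i => nth fset0 s i).
rewrite big_enum !(big_nth fset0) !big_mkord; apply; first by case: (s) s0.
move=> k l kl; have [lt_kl|lt_lk|/val_inj/eqP] := ltngtP k l.
- by apply: s_dis; rewrite // inE ltn_ord.
- by rewrite fdisjoint_sym; apply: s_dis; rewrite // inE ltn_ord.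
- by rewrite (negbTE kl).
Qed.

Lemma boundary_term0 : b fset0 = 0.
Proof.
have [b0 _ _ [D _ bD]] := b_bd; apply/eqP; rewrite eq_le b0 andbT.
by rewrite (le_trans (bD _)) // cardfs0 mulr0.
Qed.

(** Two copies of the empty set are disjoint with empty union, so [F fset0 - 2 F fset0] has norm at
    most [2 b fset0 = 0]. *)
Lemma almost_additive0 : F fset0 = 0.
Proof.
have := @almost_additive_seq [:: fset0; fset0] isT; rewrite /= fdisjoint0X.
move=> /(_ isT); rewrite !big_cons !big_nil !boundary_term0 !addr0 !fsetU0.
by rewrite opprD addrA subrr sub0r normrN normr_le0 => /eqP.
Qed.

(** By invariance [F] on a singleton depends only on its colour, so it takes finitely many values
    there. Almost additivity over the singletons of [V] then gives a linear bound. *)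
Lemma almost_additive_bounded (A : finType) (col : G -> A) :
  col_invariant col F -> exists2 C : R, 0 < C & forall V, `|F V| <= C * #|` V|%:R.
Proof.
move=> F_inv; have [b0 b_tr _ [D D0 bD]] := b_bd.
have [C C0 FC] : exists2 C : R, 0 <= C & forall x, `|F [fset x]%fset| <= C.
  (* The norm of [F] at a chosen point of colour [a], or 0 if the colour does not occur; the sum
     over all colours dominates each value. *)
  pose M (a : A) := if pselect (exists x, col x = a) is left ex
    then `|F [fset projT1 (cid ex)]%fset| else 0.
  have M0 a : 0 <= M a by rewrite /M; case: pselect.
  exists (\sum_a M a); first by rewrite sumr_ge0.
  move=> x; apply: le_trans (_ : M (col x) <= _); last first.
    by rewrite (bigD1 (col x)) //= lerDl sumr_ge0.
  rewrite /M; case: pselect => [ex|[]]; last by exists x.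
  case: cid => y /= xy; suff -> : F [fset x]%fset = F [fset y]%fset by [].
  have yE : (y = x * (x^-1 * y))%g by rewrite mulVKg.
  rewrite yE -rtranslate_fset1; apply: F_inv; exists (x^-1 * y)%g.
  apply/fmapP => z; rewrite fnd_ptranslate !fnd_crestrict mem_rtranslate !inE.
  case: eqP => // zx; rewrite zx; have -> : z = y by rewrite yE -{1}zx mulgVK.
  by rewrite xy.
(* All singletons have the same boundary term as [{1}]; the summand 1 makes the constant strictly
   positive. *)
exists (C + b [fset 1%g]%fset + 1).
  by rewrite ltr_wpDl // addr_ge0.
move=> V; have [->|V0] := eqVneq V fset0.
  by rewrite almost_additive0 normr0 cardfs0 mulr0.
have := @almost_additive_seq [seq [fset x]%fset | x <- V].
rewrite !big_map bigfcup_fset1 -size_eq0 size_map size_eq0.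
have -> : enum_fset V != [::] by apply: contraNneq V0 => V0; rewrite -cardfs_eq0 V0.
have dis : pairwise (fun V W => [disjoint V & W]%fset) [seq [fset x]%fset | x <- V].
  rewrite pairwise_map; have := fset_uniq V; rewrite uniq_pairwise.
  by apply: sub_pairwise => x y /= xy; rewrite fdisjoint1X inE.
move=> /(_ isT dis) est.
have -> : F V = (F V - \sum_(x <- V) F [fset x]%fset) + \sum_(x <- V) F [fset x]%fset.
  by rewrite subrK.
apply: le_trans (ler_normD _ _) _; apply: le_trans (lerD est (ler_norm_sum _ _ _)) _.
rewrite -big_split /= card_fset_sum1 natr_sum mulr_sumr; apply: ler_sum => x _.
rewrite mulr1 -{1}[x]mul1g -rtranslate_fset1 b_tr addrC.
by rewrite (le_trans (lerD (FC x) (lexx _))) // lerDl.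
Qed.

(* The tiles [Q k q^-1], [k] in [K], that are contained in [U]. *)
Definition interior_tiles Q U (q : G) (K : set G) : {fset G} :=
  [fset g in translates_in Q U | `[< K (g * q)%g >]]%fset.

(** * Averaging over the shifted tilings *)

Section Tiling.
Variables (Q : {fset G}) (K : set G).
Hypothesis K_sym : K = [set g^-1%g | g in K].
Hypothesis K_triv : trivIset K (fun g => [set` rtranslate Q g]).
Hypothesis K_cover : \bigcup_(g in K) [set` rtranslate Q g] = setT.
Hypothesis Q0 : Q != fset0.

Lemma tile_inv g : K g -> K g^-1%g.
Proof. by move=> Kg; rewrite K_sym; exists g. Qed.

Lemma tile_eq g h x : K g -> K h ->
  x \in rtranslate Q g -> x \in rtranslate Q h -> g = h.
Proof. by move=> Kg Kh xg xh; apply: (K_triv Kg Kh); exists x. Qed.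

Lemma tile_ex x : exists2 g, K g & x \in rtranslate Q g.
Proof.
have : (\bigcup_(g in K) [set` rtranslate Q g]) x by rewrite K_cover.
by case=> g Kg xg; exists g.
Qed.

Lemma sum_tilings (V : nmodType) (E : G -> V) U :
  \sum_(q <- Q) \sum_(g <- interior_tiles Q U q K) E g =
  \sum_(g <- translates_in Q U) E g.
Proof.
under eq_bigr do rewrite -big_fset_condE.
(* [g] occurs in the [q]-th tiling iff [(g q)^-1] is the [k] with [g^-1] in [Q k]. *)
rewrite (exchange_big_dep predT) //=; apply: eq_bigr => g _.
have [k Kk gk] := tile_ex g^-1%g.
have [q qQ gE] : exists2 q, q \in Q & k = (g * q)^-1%g.
  by exists (g^-1 * k^-1)%g; rewrite -?mem_rtranslate ?mulVKg ?invgK.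
rewrite big_fset_condE /=.
rewrite (_ : [fset _ in _ | _]%fset = [fset q]%fset) ?big_seq_fset1 //.
apply/fsetP => h; rewrite !inE /=; apply/andP/eqP => [[hQ /asboolP Kh]|->]; last first.
  by split=> //; apply/asboolP; rewrite -[(g * q)%g]invgK -gE; exact: tile_inv.
(* Both [(g h)^-1] and [k] lie in [K] and their tiles contain [g^-1], so they coincide. *)
apply/(mulgI g)/invg_inj; rewrite -gE.
apply: tile_eq (tile_inv Kh) Kk _ gk.
by rewrite mem_rtranslate invgK mulKg.
Qed.

(** Right multiplication by [q] carries these tiles back to tiles of the original tiling. *)
Lemma interior_tiles_disjoint U q g h :
  g \in interior_tiles Q U q K -> h \in interior_tiles Q U q K -> g != h ->
  [disjoint rtranslate Q g & rtranslate Q h]%fset.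
Proof.
rewrite !(mem_translates_in _ _ Q0, inE) => /andP[_ /asboolP Kg] /andP[_ /asboolP Kh].
move=> gh; apply/fdisjointP => x xg; apply: contraNN gh => xh.
apply/eqP/(mulIg q)/(tile_eq Kg Kh (x := (x * q)%g));
  by rewrite -rtranslateM mem_rtranslate mulgK.
Qed.

(** The tile around an uncovered point [x] of [U] is not contained in [U], so it contains some [y]
    outside [U]. Right invariance of the metric bounds their distance by the diameter of [Q]. *)
Lemma rest_sub_boundary U q : q \in Q ->
  [set` (U `\` \bigcup_(g <- interior_tiles Q U q K) rtranslate Q g)%fset] `<=`
  boundary S ((diam S Q)%:R : R) U.
Proof.
move=> qQ x /=; rewrite inE => /andP[xI xU]; left; split => //.
have [k Kk xk] := tile_ex (x * q)%g.
have xg : x \in rtranslate Q (k * q^-1)%g.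
  by move: xk; rewrite !mem_rtranslate invgM invgK mulgA.
have /fsubsetPn[y yg yU] : ~~ (rtranslate Q (k * q^-1) `<=` U)%fset.
  apply: contra xI => gU; apply/bigfcupP; exists (k * q^-1)%g => //.
  by rewrite !(mem_translates_in _ _ Q0, inE) gU andbT /=; apply/asboolP; rewrite mulgVK.
apply/dist_set_le; exists y; first exact/negP.
rewrite -(word_dist_rtranslate _ _ _ (k * q^-1)^-1).
by apply: word_dist_diam; rewrite -mem_rtranslate.
Qed.

Lemma tiling_estimate U q (C D : R) : generates S -> q \in Q -> 0 < C -> 0 < D ->
  (forall V, `|F V| <= C * #|` V|%:R) -> (forall V, b V <= D * #|` V|%:R) ->
  `|F U - \sum_(g <- interior_tiles Q U q K) F (rtranslate Q g)| <=
    (\sum_(g <- interior_tiles Q U q K) b Q) +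
    (C + D) * (card_set (boundary S ((diam S Q)%:R : R) U))%:R.
Proof.
move=> gen qQ C0 D0 FC bD; set I := interior_tiles Q U q K.
set rest := (U `\` \bigcup_(g <- I) rtranslate Q g)%fset.
have [_ b_tr _ _] := b_bd.
have card_rest : (#|` rest| <= card_set (boundary S ((diam S Q)%:R : R) U))%N.
  apply/fsubset_leq_card/fsubsetP => x xr.
  rewrite in_fset_set ?inE; last exact: finite_boundary.
  exact: rest_sub_boundary xr.
have := @almost_additive_seq (rest :: [seq rtranslate Q g | g <- I]) isT.
rewrite !big_cons !big_map.
have -> : (rest `|` \bigcup_(g <- I) rtranslate Q g)%fset = U.
  apply/fsetP => x; rewrite !inE orbC; case: (boolP (x \in \bigcup_(g <- I) _)%fset) => //=.
  case/bigfcupP => g; rewrite andbT !(mem_translates_in _ _ Q0, inE).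
  move=> /andP[/fsubsetP gU _] xg.
  by rewrite gU.
have -> : pairwise (fun V W => [disjoint V & W]%fset)
    (rest :: [seq rtranslate Q g | g <- I]).
  rewrite /= all_map pairwise_map; apply/andP; split.
    apply/allP => g gI; apply/fdisjointP => x; rewrite inE => /andP[+ _].
    by apply: contraNN => xg; apply/bigfcupP; exists g; rewrite ?gI.
  have := fset_uniq I; rewrite uniq_pairwise.
  apply: (sub_in_pairwise (P := mem I)); last exact/allP.
  move=> g h gI hI /= gh; exact: (interior_tiles_disjoint gI hI gh).
move=> /(_ isT); set T := \sum_(g <- I) F _ => est.
(* The uncovered rest enters twice: as a piece in almost additivity, at cost [b rest <= D |rest|],
   and when [F rest] is removed, at cost [C |rest|]. Hence the factor [C + D]. *)
have -> : F U - T = F U - (F rest + T) + F rest.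
  by rewrite opprD [- F rest - T]addrC addrA subrK.
apply: le_trans (ler_normD _ _) _; apply: le_trans (lerD est (FC _)) _.
rewrite [b rest + _]addrC -addrA; apply: lerD.
  by apply: ler_sum => g _; rewrite b_tr.
apply: le_trans (lerD (bD _) (lexx _)) _.
by rewrite addrC -mulrDl; apply: ler_wpM2l; rewrite ?ler_nat // addr_ge0 ?ltW.
Qed.

Lemma averaged_tiling_estimate U (C D : R) : generates S -> 0 < C -> 0 < D ->
  (forall V, `|F V| <= C * #|` V|%:R) -> (forall V, b V <= D * #|` V|%:R) ->
  `|#|` Q|%:R *: F U - \sum_(g <- translates_in Q U) F (rtranslate Q g)| <=
    #|` U|%:R * b Q +
    #|` Q|%:R * ((C + D) * (card_set (boundary S ((diam S Q)%:R : R) U))%:R).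
Proof.
move=> gen C0 D0 FC bD; have [b0 _ _ _] := b_bd.
have sumQ (V : lmodType R) (v : V) : #|` Q|%:R *: v = \sum_(q <- Q) v.
  by rewrite card_fset_sum1 natr_sum scaler_suml; under eq_bigr do rewrite scale1r.
set B := (C + D) * _.
rewrite sumQ -sum_tilings -sumrB; apply: le_trans (ler_norm_sum _ _ _) _.
(* Reading the real [B] as a vector of [R^o] lets [sumQ] expand this product as well. *)
rewrite (_ : #|` Q|%:R * B = #|` Q|%:R *: (B : R^o)) // sumQ.
apply: le_trans (_ : \sum_(q <- Q) (\sum_(g <- interior_tiles Q U q K) b Q + B) <= _).
  by rewrite !big_seq; apply: ler_sum => q qQ; exact: tiling_estimate.
rewrite big_split lerD2r sum_tilings /=.
rewrite (_ : \sum_(_ <- _) _ = #|` translates_in Q U|%:R * b Q); last first.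
  by rewrite card_fset_sum1 natr_sum mulr_suml; under [RHS]eq_bigr do rewrite mul1r.
by rewrite ler_wpM2r // ler_nat leq_card_translates_in.
Qed.

End Tiling.
End AlmostAdditive.

(** * Limits along Foelner sequences *)

(** For fixed [r] the boundary is at most [M] times [|S U_j \ U_j|], with [M] independent of [j]. *)
Lemma folner_boundary (R : realType) (G : groupType) (S : {fset G})
    (U : nat -> {fset G}) (r : nat) : generates S -> folner R S U ->
  (fun j => (card_set (boundary S (r%:R : R) (U j)))%:R / #|` U j|%:R : R)
    @ \oo --> (0 : R).
Proof.
move=> gen [_ U_cvg].
pose M : R := (#|` word_ball S r| * r.*2)%:R.
apply: (@squeeze_cvgr _ _ _ _ (cst 0)
  (fun j => M * (#|` (lmul S (U j) `\` U j)%fset|%:R / #|` U j|%:R))).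
- apply: nearW => j; rewrite divr_ge0 //= mulrA ler_wpM2r ?invr_ge0 //.
  by rewrite -natrM ler_nat -mulnA -doubleMl; exact: card_boundary.
- exact: cvg_cst.
- by rewrite -[X in _ --> X](mulr0 M); apply: cvgMr.
Qed.

Section Frequencies.
Variables (R : realType) (G : groupType) (S : {fset G}) (A : finType).
Variables (col : G -> A) (X : normedModType R).
Variables (F : {fset G} -> X) (b : {fset G} -> R).
Hypotheses (S_gen : generates S) (b_bd : boundary_term S b).
Hypotheses (F_inv : col_invariant col F) (F_aadd : almost_additive F b).

Lemma mean_rel_occ (Q : {fset G}) (U : nat -> {fset G}) (C D : R) j :
  symmetrically_tiles Q -> Q != fset0 -> U j != fset0 -> 0 < C -> 0 < D ->
  (forall V : {fset G}, `|F V| <= C * #|` V|%:R) ->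
  (forall V : {fset G}, b V <= D * #|` V|%:R) ->
  `|mean F U j - \sum_(f : {ffun Q -> A})
      rel_occ R col U (pattern_of f) j *:
        (#|` Q|%:R^-1 *: pattern_fun col F (pattern_of f))| <=
  b Q / #|` Q|%:R + (C + D) *
    ((card_set (boundary S ((diam S Q)%:R : R) (U j)))%:R / #|` U j|%:R).
Proof.
move=> [K [K_sym K_triv K_cover]] Q0 U0 C0 D0 FC bD.
have q0 : 0 < #|` Q|%:R :> R by rewrite ltr0n cardfs_gt0.
have u0 : 0 < #|` U j|%:R :> R by rewrite ltr0n cardfs_gt0.
have := averaged_tiling_estimate b_bd F_aadd K_sym K_triv K_cover Q0 (U j) S_gen C0 D0 FC bD.
rewrite -(sum_occ _ Q0 F_inv) /mean /rel_occ.
set q : R := #|` Q|%:R in q0 *; set u : R := #|` U j|%:R in u0 *.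
set B : R := (card_set _)%:R => est.
set E := (X in `|X|).
have EE : E = (q * u)^-1 *: (q *: F (U j) - \sum_(f : {ffun Q -> A})
    (occ (pattern_of f) (crestrict col (U j)))%:R *: pattern_fun col F (pattern_of f)).
  rewrite /E scalerBr scaler_sumr; congr (_ - _).
    by rewrite scalerA; congr (_ *: _); field; rewrite !gt_eqF.
  by apply: eq_bigr => f _; rewrite !scalerA; congr (_ *: _); field; rewrite !gt_eqF.
rewrite EE normrZ gtr0_norm ?invr_gt0 ?mulr_gt0 // mulrC ler_pdivrMr ?mulr_gt0 //.
apply: le_trans est _; rewrite le_eqVlt; apply/orP; left; apply/eqP.
by field; rewrite !gt_eqF.
Qed.

End Frequencies.

Lemma cvg_sum_scale (R : realType) (X : normedModType R) (I : finType)
    (u : I -> nat -> R) (l : I -> R) (x : I -> X) :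
  (forall i, u i @ \oo --> l i) ->
  (fun j => \sum_i u i j *: x i) @ \oo --> \sum_i l i *: x i.
Proof.
move=> ul; apply: cvg_big => [|i _]; first exact: add_continuous.
by apply: cvgZ; [exact: ul|exact: cvg_cst].
Qed.

(** Fix [n] with [beta n] small, then let [j] grow: the tail of [m] stays close to [t n], so [m] is
    Cauchy and completeness applies. Passing to the limit in [j] for each fixed [n] removes [e n j]
    and leaves [beta n]. *)
Lemma cvg_approx (R : realType) (X : completeNormedModType R) (m : nat -> X)
    (s : nat -> nat -> X) (t : nat -> X) (beta : nat -> R) (e : nat -> nat -> R) :
  (forall n j, `|m j - s n j| <= beta n + e n j) ->
  (forall n, s n @ \oo --> t n) ->
  (forall n, e n @ \oo --> (0 : R)) ->
  beta @ \oo --> (0 : R) ->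
  cvgn m /\ forall n, `|limn m - t n| <= beta n.
Proof.
move=> ms st e0 beta0.
have m_cvg : cvgn m.
  apply: cauchy_cvg; apply: cauchy_exP => _ /posnumP[eps].
  have [n _ /(_ n (leqnn n)) /= bn] : \forall n \near \oo, `|beta n| < eps%:num / 3.
    by apply/cvgr0_norm_lt.
  exists (t n).
  have sn : \forall j \near \oo, `|t n - s n j| < eps%:num / 3.
    by have /cvgrPdist_lt := st n; apply.
  have en : \forall j \near \oo, `|e n j| < eps%:num / 3.
    by apply/cvgr0_norm_lt.
  near=> j => /=; rewrite -ball_normE /ball_ /=.
  have -> : t n - m j = (t n - s n j) - (m j - s n j) by rewrite opprB addrA subrK.
  apply: le_lt_trans (ler_normB _ _) _.
  have h1 : `|t n - s n j| < eps%:num / 3 by near: j.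
  have h2 : `|e n j| < eps%:num / 3 by near: j.
  have h3 := ms n j; have := ler_norm (e n j); have := ler_norm (beta n).
  by lra.
split=> // n.
apply: (@ler_cvg_to _ \oo _ _ (fun j => `|m j - s n j|) (fun j => beta n + e n j)).
- exact: cvg_norm (cvgB m_cvg (st n)).
- by rewrite -[X in _ --> X]addr0; exact: cvgD (cvg_cst _) (e0 n).
- exact: nearW.
Unshelve. all: by end_near.
Qed.

Theorem corollary3p2 (R : realType) (G : groupType) (S : {fset G})
  (S_sym : symmetric_fset S) (S_gen : generates S) (G_amen : amenable R S)
  (A : finType) (col : G -> A)
  (Q : nat -> {fset G}) (Q_folner : folner R S Q)
  (Q_tiles : forall n, symmetrically_tiles (Q n))
  (U : nat -> {fset G}) (U_folner : folner R S U)
  (freq_ex : forall (n : nat) (P : pattern G A), domf P = Q n ->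
     cvgn (rel_occ R col U P))
  (X : completeNormedModType R) (F : {fset G} -> X) (b : {fset G} -> R)
  (b_bd : boundary_term S b)
  (F_inv : col_invariant col F) (F_aadd : almost_additive F b) :
  [/\ exists2 C : R, 0 < C & forall V : {fset G}, `|F V| <= C * (#|` V|)%:R,
      cvgn (mean F U) &
      forall C D : R, 0 < C -> 0 < D ->
        (forall V : {fset G}, `|F V| <= C * (#|` V|)%:R) ->
        (forall V : {fset G}, b V <= D * (#|` V|)%:R) ->
        forall j n : nat,
          `| limn (mean F U) - mean F U j |
            <= 2 * (b (Q n) / (#|` Q n|)%:R)
               + (C + D) * ((card_set (boundary S ((diam S (Q n))%:R : R) (U j)))%:R
                              / (#|` U j|)%:R)
               + C * \sum_(f : {ffun Q n -> A})
                       `| rel_occ R col U (pattern_of f) j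
                          - frequency R col U (pattern_of f) |
          /\
          `| limn (mean F U)
             - \sum_(f : {ffun Q n -> A})
                 frequency R col U (pattern_of f)
                   *: ((#|` Q n|)%:R^-1 *: pattern_fun col F (pattern_of f)) |
            <= b (Q n) / (#|` Q n|)%:R ].
Proof.
(* These auxiliary constants serve to prove convergence; they affect only the error that vanishes in
   [j], so the second bound is free of them. *)
have [C1 C10 FC1] := almost_additive_bounded b_bd F_aadd F_inv.
have [_ _ b_fol [D1 D10 bD1]] := b_bd.
have [Q0 U0] := (Q_folner.1, U_folner.1).
pose x n (f : {ffun Q n -> A}) :=
  #|` Q n|%:R^-1 *: pattern_fun col F (pattern_of f).
pose t n := \sum_f frequency R col U (pattern_of f) *: x n f.
have s_cvg n : (fun j => \sum_f rel_occ R col U (pattern_of f) j *: x n f)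
    @ \oo --> t n.
  by apply: cvg_sum_scale => f; exact: freq_ex.
have e_cvg n : (fun j => (C1 + D1) *
    ((card_set (boundary S ((diam S (Q n))%:R : R) (U j)))%:R / #|` U j|%:R))
    @ \oo --> (0 : R).
  by rewrite -[X in _ --> X](mulr0 (C1 + D1)); apply: cvgMr; exact: folner_boundary.
have [F_cvg F_lim] := cvg_approx
  (fun n j => mean_rel_occ S_gen b_bd F_inv F_aadd
     (Q_tiles n) (Q0 n) (U0 j) C10 D10 FC1 bD1)
  s_cvg e_cvg (b_fol Q Q_folner).
split=> //; first by exists C1.
move=> C D C0 D0 FC bD j n; split; last exact: F_lim.
have est := mean_rel_occ S_gen b_bd F_inv F_aadd (Q_tiles n) (Q0 n) (U0 j) C0 D0 FC bD.
set s := \sum_f _ in est.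
(* Each coefficient [x n f] has norm at most [C], because the pattern has domain [Q n] and its value
   is divided by the cardinality of [Q n]. *)
have ts : `|t n - s| <= C * \sum_(f : {ffun Q n -> A})
    `| rel_occ R col U (pattern_of f) j - frequency R col U (pattern_of f) |.
  rewrite -sumrB mulr_sumr; apply: le_trans (ler_norm_sum _ _ _) _.
  apply: ler_sum => f _; rewrite -scalerBl normrZ distrC mulrC ler_wpM2r //.
  have q0 : 0 < #|` Q n|%:R :> R by rewrite ltr0n cardfs_gt0.
  rewrite normrZ gtr0_norm ?invr_gt0 // mulrC ler_pdivrMr //.
  exact: norm_pattern_fun.
(* The first and third differences each contribute [b (Q n) / |Q n|], which gives the factor 2; the
   second is the frequency error. *)
have -> : limn (mean F U) - mean F U j =
    (limn (mean F U) - t n) + (t n - s) - (mean F U j - s).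
  by rewrite subrKA opprB addrA subrK.
apply: le_trans (ler_normB _ _) _; apply: le_trans (lerD (ler_normD _ _) est) _.
by have := F_lim n; lra.
Qed.
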